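(* Let $N=(V,A,c)$ be a network and let $x,y,z\in V$ with $y\neq z$. Then $\lambda^N_{yz}(x)=\varphi^N_{yz}(x)=\delta^N_{yz}(x)$.
   Context: $\mathbb{N}_0$ is the set of non-negative integers; $[m]=\{1,\dots,m\}$ and $[0]=\varnothing$. A network $N=(V,A,c)$ consists of a finite set $V$ with $|V|\ge 2$, the arc set $A=\{(u,v)\in V^2: u\ne v\}$ of the complete digraph on $V$, and a capacity function $c:A\to\mathbb{N}_0$. For $u\in V$, $A_u^+$ is the set of arcs $(u,v)\in A$ and $A_u^-$ is the set of arcs $(v,u)\in A$. Flows. For distinct $y,z\in V$, a flow from $y$ to $z$ in $N$ is a function $f:A\to\mathbb{N}_0$ with $f(a)\le c(a)$ for all $a\in A$ and $\sum_{a\in A_u^-}f(a)=\sum_{a\in A_u^+}f(a)$ for all $u\in V\setminus\{y,z\}$. Its value is $v(f)=\sum_{a\in A_y^+}f(a)-\sum_{a\in A_y^-}f(a)$. $\varphi^N_{yz}$ denotes the maximum of $v(f)$ over all flows $f$ from $y$ to $z$ in $N$; $\mathcal{M}(N,y,z)$ is the set of flows from $y$ to $z$ in $N$ with value $\varphi^N_{yz}$. For a flow $f$ from $y$ to $z$ and $u\in V$, set $f(u)=\sum_{a\in A_u^+}f(a)$ if $u\notin\{y,z\}$ and $f(u)=v(f)$ if $u\in\{y,z\}$; for $X\subseteq V$, set $f(X)=\sum_{u\in X}f(u)$. Define $\delta^N_{yz}(X)=\min_{f\in\mathcal{M}(N,y,z)}f(X)$. For $X\subseteq V$, $N_X=(V,A,c_X)$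 is the network with $c_X(a)=0$ if at least one endpoint of $a$ lies in $X$, and $c_X(a)=c(a)$ otherwise. Define $\varphi^N_{yz}(X)=\varphi^N_{yz}-\varphi^{N_X}_{yz}$. Paths. A path from $y$ to $z$ in $N$ is given by distinct vertices $x_1=y,x_2,\dots,x_k=z$ ($k\ge2$) with arcs $(x_i,x_{i+1})$, $i\in[k-1]$, all of capacity at least $1$; for such a path $\gamma$, $V(\gamma)$ and $A(\gamma)$ denote its sets of vertices and arcs. It passes through $X\subseteq V$ if $X\cap V(\gamma)\neq\varnothing$. For $m\in\mathbb{N}_0$, a sequence $\boldsymbol{\gamma}=(\gamma_j)_{j\in[m]}$ of $m$ paths (repetitions allowed) from $y$ to $z$ in $N$ is arc-disjoint if $|\{j\in[m]:a\in A(\gamma_j)\}|\le c(a)$ for every $a\in A$; its length is $m$ (the empty sequence, of length $0$, is arc-disjoint). $\mathcal{M}^N_{yz}$ is the set of arc-disjoint sequences of paths from $y$ to $z$ in $N$ of maximum length. $l_X(\boldsymbol{\gamma})$ is the number of indices $j\in[m]$ such that $\gamma_j$ passes through $X$. Define $\lambda^N_{yz}(X)=\min_{\boldsymbol{\gamma}\in\mathcal{M}^N_{yz}}l_X(\boldsymbol{\gamma})$. For a vertex $x$, write $\varphi^N_{yz}(x)$, $\lambda^N_{yz}(x)$, $\delta^N_{yz}(x)$ for $\varphi^N_{yz}(\{x\})$, $\lambda^N_{yz}(\{x\})$, $\delta^N_{yz}(\{x\})$. *)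

(* Defs.v *)
From HB Require Import structures.
From mathcomp Require Import all_boot all_order all_algebra.

Set Implicit Arguments.
Unset Strict Implicit.
Unset Printing Implicit Defensive.

Import Order.TTheory GRing.Theory Num.Theory.

Definition arc (V : finType) := {a : V * V | a.1 != a.2}.

Definition src (V : finType) (a : arc V) : V := (val a).1.
Definition tgt (V : finType) (a : arc V) : V := (val a).2.

(* The bound 2 <= #|V| lives in the structure; the arc set is determined by V
   and the capacity function determines the rest. *)
Record network (V : finType) := Network {
  capacity :> arc V -> nat;
  network_card : 2 <= #|V|
}.

Section Flows.
Variables (V : finType) (N : network V) (y z : V).

(* A dependent finite function with values in 'I_(N a).+1 is the same thing as
   a function f : A -> nat with f a <= N a for every arc a; conservation is
   imposed separately by [is_flow]. *)
Definition bounded_fun := {dffun forall a : arc V, 'I_(N a).+1}.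

Implicit Types (f : bounded_fun) (u : V) (X : {set V}).

Definition outflow f u : nat := \sum_(a : arc V | src a == u) f a.
Definition inflow f u : nat := \sum_(a : arc V | tgt a == u) f a.

Definition is_flow f : bool :=
  [forall u, (u \notin [set y; z]) ==> (inflow f u == outflow f u)].

(* Integer-valued, since a flow from y to z may have negative value. *)
Definition flow_value f : int := ((outflow f y)%:Z - (inflow f y)%:Z)%R.

Definition zero_flow : bounded_fun := [ffun a => ord0].

Lemma zero_flowP : is_flow zero_flow.
Proof.
apply/forallP => u; apply/implyP => _; rewrite /inflow /outflow.
by rewrite !big1 // => a _; rewrite ffunE.
Qed.

(* [zero_flow] only witnesses that there is a flow to maximize over. *)
Definition max_flow : bounded_fun :=
  [arg max_(f > zero_flow | is_flow f) flow_value f]%O.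

Definition phi : int := flow_value max_flow.

Definition max_flows : {set bounded_fun} :=
  [set f | is_flow f & flow_value f == phi].

Lemma phi_ge f : is_flow f -> (flow_value f <= phi)%R.
Proof.
rewrite /phi /max_flow; case: Order.TotalTheory.arg_maxP => [|g _ gmax /gmax //].
exact: zero_flowP.
Qed.

Lemma max_flow_in : max_flow \in max_flows.
Proof.
rewrite inE eqxx andbT /max_flow.
by case: Order.TotalTheory.arg_maxP => //; exact: zero_flowP.
Qed.

Definition flow_at f u : int :=
  if u \in [set y; z] then flow_value f else (outflow f u)%:Z%R.

Definition flow_through f X : int := (\sum_(u in X) flow_at f u)%R.

Definition delta X : int :=
  flow_through
    [arg min_(f < max_flow | f \in max_flows) flow_through f X]%O X.

Lemma delta_le f X : f \in max_flows -> (delta X <= flow_through f X)%R.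
Proof.
rewrite /delta; case: Order.TotalTheory.arg_minP => [|g _ gmin /gmin //].
exact: max_flow_in.
Qed.

Lemma delta_attained X :
  exists2 f, f \in max_flows & flow_through f X = delta X.
Proof.
rewrite /delta; case: Order.TotalTheory.arg_minP => [|g gM _].
  exact: max_flow_in.
by exists g.
Qed.

End Flows.

Definition del_capacity (V : finType) (N : network V) (X : {set V})
    (a : arc V) : nat :=
  if (src a \in X) || (tgt a \in X) then 0 else N a.

Definition del_network (V : finType) (N : network V) (X : {set V}) :
  network V := Network (del_capacity N X) (network_card N).

Definition phi_set (V : finType) (N : network V) (y z : V) (X : {set V}) : int :=
  (phi N y z - phi (del_network N X) y z)%R.

Section Paths.
Variables (V : finType) (N : network V) (y z : V).

Definition usable (u v : V) : bool :=
  [exists a : arc V, [&& src a == u, tgt a == v & 1 <= N a]].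

(* s lists the vertices x_1, ..., x_k. *)
Definition is_path (s : seq V) : bool :=
  if s is x :: t then
    [&& x == y, last x t == z, 2 <= size s, uniq s & path usable x t]
  else false.

(* Lists of distinct vertices have size at most #|V|, so bounding the size
   here only serves to obtain a finite type; see [is_path_size]. *)
Definition npath := {s : #|V|.-bseq V | is_path s}.

Lemma is_path_size s : is_path s -> size s <= #|V|.
Proof.
by case: s => // x t /and5P[_ _ _ /card_uniqP <- _]; exact: max_card.
Qed.

Definition path_vertices (p : npath) : {set V} := [set u in (val p : seq V)].

Definition path_arcs (p : npath) : {set arc V} :=
  [set a : arc V | (src a, tgt a) \in zip (val p) (behead (val p))].

Definition passes_through (X : {set V}) (p : npath) : bool :=
  X :&: path_vertices p != set0.

Definition arc_disjoint (g : seq npath) : bool :=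
  [forall a : arc V, count (fun p => a \in path_arcs p) g <= N a].

Definition has_disjoint_paths (m : nat) : bool :=
  [exists g : m.-tuple npath, arc_disjoint g].

Lemma has_disjoint_paths_ex : exists m, has_disjoint_paths m.
Proof. by exists 0; apply/existsP; exists [tuple]; apply/forallP. Qed.

Lemma path_arcs_neq0 p : 0 < #|path_arcs p|.
Proof.
rewrite card_gt0; apply/set0Pn.
suff [a pa] : exists a : arc V,
    (src a, tgt a) \in zip (val p) (behead (val p)) by exists a; rewrite inE.
move: (valP p); case: (val p : seq V) => [|x [|x' t]] //=.
  by rewrite !andbF.
case/and4P=> _ _ _ /andP[/existsP[a /and3P[/eqP ax /eqP ax' _]] _].
by exists a; rewrite ax ax' mem_head.
Qed.

Lemma has_disjoint_paths_le m :
  has_disjoint_paths m -> m <= \sum_(a : arc V) N a.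
Proof.
case/existsP=> g /forallP gN.
apply: leq_trans (leq_sum _ (fun a _ => gN a)).
rewrite -[X in X <= _](size_tuple g).
elim: (g : seq _) => [|p t IHt] //=.
rewrite big_split /= -add1n leq_add //.
by rewrite -big_mkcond sum1_card; exact: path_arcs_neq0.
Qed.

Definition max_paths : nat :=
  ex_maxn has_disjoint_paths_ex has_disjoint_paths_le.

Definition passing_count (X : {set V}) (g : seq npath) : nat :=
  count (passes_through X) g.

(* An element of the set of maximum arc-disjoint sequences is a
   [max_paths]-tuple g of paths with [arc_disjoint g]. *)
Definition has_passing_count (X : {set V}) (l : nat) : bool :=
  [exists g : max_paths.-tuple npath,
     arc_disjoint g && (passing_count X g == l)].

Lemma has_passing_count_ex X : exists l, has_passing_count X l.
Proof.
have: has_disjoint_paths max_paths by rewrite /max_paths; case: ex_maxnP.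
case/existsP=> g gD; exists (passing_count X g).
by apply/existsP; exists g; rewrite gD eqxx.
Qed.

Definition lambda (X : {set V}) : nat := ex_minn (has_passing_count_ex X).

End Paths.

(* Main.v *)
From mathcomp Require Import all_boot all_order all_algebra.
From mathcomp Require Import ring zify.
Require Import Defs.

(** The three quantities are compared in a cycle,
    lambda(x) <= delta(x) <= phi(x) <= lambda(x).

    - lambda <= delta.  A flow of value m contains m paths from y to z whose
      joint use of each arc is at most the flow there ([flow_decomposition]):
      remove one path at a time, such a path existing because the set of
      vertices reachable through the support cannot be left, yet emits m > 0
      units unless it contains z.  Every path through x <> z uses one arc out
      of x, so at most f(x) of these paths pass through x when x is not a
      terminal; when it is one, f(x) = m bounds them anyway.  The same
      decomposition shows that the maximum number of arc-disjoint paths is the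
      maximum flow value ([max_pathsE]).

    - delta <= phi.  This is the heart of the matter: some maximum flow sends
      at most phi(x) units through x.  Take a maximum flow f of N and a maximum
      flow g of N_x; their values differ by d = phi(x).  The difference f - g,
      with negative entries turned into flow on the reversed arcs, is a flow of
      value d in the residual network of g.  Decompose it into d simple paths
      and add just these paths to g ([augment_flow]).  The circulations left
      out do not affect the value, so the result is again maximum in N; and
      since g does not use x and each of the d paths leaves x at most once, at
      most d units pass through x.  If x is y or z, then N_x carries no flow,
      and both sides are the maximum value.

    - phi <= lambda.  In a maximum sequence of arc-disjoint paths, the paths
      avoiding X are arc-disjoint in N_X, so they add up to a flow there.

    Flows are handled through the excess (outflow minus inflow) at each vertex:
    a flow of value v from y to z is a function whose excess is v at y, -v at z
    and 0 elsewhere.  In this form ([st_flow]) sums and differences of flows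
    are immediate. *)

Set Implicit Arguments.
Unset Strict Implicit.
Unset Printing Implicit Defensive.

Import Order.TTheory GRing.Theory Num.Theory.
Local Open Scope ring_scope.

(** * Excess of functions on arcs *)

Section Excess.
Variable V : finType.
Implicit Types (f g : arc V -> int) (u y z : V) (v : int).

Definition out_sum (f : arc V -> nat) u : nat :=
  (\sum_(a : arc V | src a == u) f a)%N.

Definition excess f u : int :=
  \sum_(a : arc V | src a == u) f a - \sum_(a : arc V | tgt a == u) f a.

Lemma eq_excess f g u : f =1 g -> excess f u = excess g u.
Proof. by move=> fg; congr (_ - _); apply: eq_bigr => a _; rewrite fg. Qed.

Lemma excessD f g u : excess (fun a => f a + g a) u = excess f u + excess g u.
Proof. by rewrite /excess !big_split /=; ring. Qed.

Lemma excessB f g u : excess (fun a => f a - g a) u = excess f u - excess g u.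
Proof. by rewrite /excess !sumrB; ring. Qed.

Lemma rev_arc_subproof (a : arc V) : (tgt a, src a).1 != (tgt a, src a).2.
Proof. by rewrite eq_sym; exact: valP a. Qed.

Definition rev_arc (a : arc V) : arc V :=
  exist (fun p : V * V => p.1 != p.2) (tgt a, src a) (rev_arc_subproof a).

Lemma rev_arcK : involutive rev_arc.
Proof. by move=> a; apply: val_inj; case: a => [[]]. Qed.

Lemma excess_rev f u : excess (f \o rev_arc) u = - excess f u.
Proof.
rewrite /excess (reindex_inj (inv_inj rev_arcK)) /=.
rewrite [X in _ - X](reindex_inj (inv_inj rev_arcK)) /= opprB.
by congr (_ - _); apply: eq_bigr => a _; rewrite rev_arcK.
Qed.

(** Arcs inside [S] cancel, so only the arcs crossing its boundary count. *)
Lemma sum_excess f (S : {set V}) :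
  \sum_(u in S) excess f u =
  \sum_(a : arc V) f a * ((src a \in S)%:R - (tgt a \in S)%:R).
Proof.
have sumE (h : arc V -> V) :
    \sum_(u in S) \sum_(a : arc V | h a == u) f a
    = \sum_(a : arc V) f a * (h a \in S)%:R.
  rewrite (exchange_big_dep predT) //=; apply: eq_bigr => a _.
  have [hS|hS] := boolP (h a \in S).
    rewrite (big_pred1 (h a)) ?mulr1 // => u /=.
    by rewrite [h a == u]eq_sym; case: eqP => [->|]; rewrite ?hS ?andbF.
  rewrite mulr0 big_pred0 // => u.
  by apply/andP => -[uS /eqP hu]; rewrite hu uS in hS.
by rewrite sumrB !sumE -sumrB; apply: eq_bigr => a _; rewrite mulrBr.
Qed.

(** When y <> z, the right-hand side is v at y, -v at z and 0 elsewhere; stating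
    the sink value too makes the condition linear in the pair (f, v). *)
Definition st_flow y z f v :=
  forall u, excess f u = v * ((u == y)%:R - (u == z)%:R).

End Excess.

Arguments rev_arc {V} a.

Lemma Posz_sum (I : finType) (P : pred I) (F : I -> nat) :
  (\sum_(i | P i) F i)%N%:Z = \sum_(i | P i) (F i)%:Z.
Proof. exact: (big_morph Posz PoszD erefl). Qed.

(** * Flows of a network *)

Section BoundedFlows.
Variables (V : finType) (N : network V) (y z : V).
Hypothesis hyz : y <> z.

Lemma excess_nat (f : arc V -> nat) u :
  excess (Posz \o f) u =
  (out_sum f u)%:Z - (\sum_(a : arc V | tgt a == u) f a)%N%:Z.
Proof. by rewrite /excess /out_sum !Posz_sum. Qed.

(** The excess at z is forced, since the excesses of all vertices sum to 0. *)
Lemma is_flow_st_flow (F : bounded_fun N) :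
  is_flow y z F -> st_flow y z (fun a => (F a)%:Z) (flow_value y F).
Proof.
move=> /forallP Fcons.
have exY : excess (fun a => (F a)%:Z) y = flow_value y F by rewrite excess_nat.
have ex0 u : u != y -> u != z -> excess (fun a => (F a)%:Z) u = 0.
  move=> uy uz; have := Fcons u; rewrite !inE negb_or uy uz /= => /eqP E.
  by rewrite excess_nat -[out_sum _ u]/(outflow F u) -E subrr.
have yz : (y == z) = false by apply/eqP.
have exZ : excess (fun a => (F a)%:Z) z = - flow_value y F.
  have := sum_excess (fun a => (F a)%:Z) [set: V].
  rewrite [RHS]big1 => [|a _]; last by rewrite !inE subrr mulr0.
  rewrite (bigD1 y) ?inE //= (bigD1 z) ?inE 1?eq_sym ?yz //= big1 => [|u].
    by rewrite exY; lia.
  by case/andP=> /andP[_ uy] uz; exact: ex0.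
move=> u; case: (eqVneq u y) => [->|uy].
  by rewrite yz exY subr0 mulr1.
case: (eqVneq u z) => [->|uz]; first by rewrite exZ sub0r mulrN1.
by rewrite ex0 // subr0 mulr0.
Qed.

Lemma st_flow_is_flow (f : arc V -> nat) v :
    (forall a, f a <= N a)%N -> st_flow y z (Posz \o f) v ->
  exists F : bounded_fun N,
    [/\ is_flow y z F, flow_value y F = v &
        forall u, outflow F u = out_sum f u].
Proof.
move=> fN fv; pose F : bounded_fun N := [ffun a => inord (f a)].
have FE a : F a = f a :> nat by rewrite ffunE inordK // ltnS.
have outE u : outflow F u = out_sum f u by apply: eq_bigr => a _; rewrite FE.
have exE u : (outflow F u)%:Z - (inflow F u)%:Z = excess (Posz \o f) u.
  rewrite excess_nat outE; congr (_ - Posz _).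
  by apply: eq_bigr => a _; rewrite FE.
exists F; split=> //.
  apply/forallP=> u; apply/implyP; rewrite !inE negb_or => /andP[uy uz].
  have := exE u; rewrite fv (negPf uy) (negPf uz) subr0 mulr0 => E.
  by apply/eqP; lia.
rewrite /flow_value exE fv eqxx.
by have /eqP/negPf-> := hyz; rewrite subr0 mulr1.
Qed.

Lemma phi_ge0 : 0 <= phi N y z.
Proof.
apply: le_trans (phi_ge (zero_flowP N y z)).
by rewrite /flow_value /outflow /inflow !big1 // => a _; rewrite ffunE.
Qed.

End BoundedFlows.

(** * Arcs of a path *)

Lemma path_zip (T : eqType) (e : rel T) x t (p : T * T) :
  path e x t -> p \in zip (x :: t) t -> e p.1 p.2.
Proof.
elim: t x => //= x' t IH x /andP[exx' et]; rewrite in_cons.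
by case/orP=> [/eqP->|]; last exact: IH.
Qed.

Lemma mem_zip_behead (T : eqType) (x : T) t (p : T * T) :
  p \in zip (x :: t) t -> p.1 \in x :: t /\ p.2 \in x :: t.
Proof.
elim: t x => //= x' t IH x; rewrite in_cons => /orP[/eqP-> /=|/IH[p1 p2]].
  by rewrite !inE !eqxx orbT.
by rewrite !(in_cons x) p1 p2 !orbT.
Qed.

Lemma count_zip_src (T : eqType) (u x : T) t :
  count (fun p => p.1 == u) (zip (x :: t) t) = count_mem u (belast x t).
Proof. by elim: t x => //= x' t IH x; rewrite -IH. Qed.

Lemma count_zip_tgt (T : eqType) (u x : T) t :
  count (fun p => p.2 == u) (zip (x :: t) t) = count_mem u t.
Proof. by elim: t x => //= x' t IH x; rewrite -(IH x'). Qed.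

(** Transfers counting from arcs, a subtype of pairs, to lists of pairs; the
    hypotheses make every entry of the list exactly one arc. *)
Lemma sum_mem_arcs (V : finType) (h : pred (V * V)) (L : seq (V * V)) :
    uniq L -> all (fun p => p.1 != p.2) L ->
  (\sum_(a : arc V | h (val a)) (val a \in L))%N = count h L.
Proof.
elim: L => [|p L IH] /=; first by rewrite big1.
case/andP=> pL uL /andP[pne Lne]; rewrite -IH //.
pose b : arc V := Sub p pne.
transitivity
    (\sum_(a : arc V | h (val a)) ((a == b) + (val a \in L)))%N.
  apply: eq_bigr => a _; rewrite in_cons -val_eqE /=.
  by case: eqP => [->|//]; rewrite (negPf pL).
rewrite big_split /=; congr addn; rewrite big_mkcond (bigD1 b) //= eqxx big1.
  by rewrite addn0; case: (h p).
by move=> a /negPf->; rewrite if_same.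
Qed.

Section PathLoads.
Variables (V : finType) (N : network V) (y z : V).
Implicit Types (p : npath N y z) (g : seq (npath N y z)).

Definition load g (a : arc V) : nat := count (fun p => a \in path_arcs p) g.

Lemma npathP p : exists t,
  [/\ val p = y :: t :> seq V, last y t = z & uniq (y :: t)].
Proof.
move: (valP p); case: (val p : seq V) => //= x t.
by case/and5P=> /eqP<- /eqP<- _ u _; exists t.
Qed.

Lemma path_arcs_vertices p a : a \in path_arcs p ->
  src a \in path_vertices p /\ tgt a \in path_vertices p.
Proof.
by have [t [pE _ _]] := npathP p; rewrite !inE pE => /mem_zip_behead.
Qed.

Lemma sum_path_arcs p (h : pred (V * V)) :
  (\sum_(a : arc V | h (val a)) (a \in path_arcs p))%N =
  count h (zip (val p) (behead (val p))).
Proof.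
have [t [pE _ ut]] := npathP p; rewrite pE /= -sum_mem_arcs.
- by apply: eq_bigr => a _; rewrite inE pE -surjective_pairing.
- exact: zip_uniql.
- apply/allP=> e; apply: (@path_zip _ [rel u v | u != v]).
  by move: ut; rewrite uniq_pairwise => /pairwise_sorted.
Qed.

(** Sources of the arcs of a path are all its vertices but the last, targets
    all but the first; both lists with the missing end added enumerate the
    vertices. *)
Lemma excess_path p u :
  excess (fun a => (a \in path_arcs p : nat)%:Z) u = (u == y)%:R - (u == z)%:R.
Proof.
rewrite (excess_nat (fun a => a \in path_arcs p)) /out_sum.
rewrite (sum_path_arcs p (fun e => e.1 == u)).
rewrite (sum_path_arcs p (fun e => e.2 == u)).
have [t [-> lt _]] := npathP p; rewrite count_zip_src count_zip_tgt.
have := congr1 (count_mem u) (lastI y t); rewrite -cats1 count_cat /= lt addn0.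
rewrite [u == y]eq_sym [u == z]eq_sym; lia.
Qed.

(** A path repeats no vertex, so it leaves each vertex it visits exactly once,
    except its end z, which it never leaves. *)
Lemma out_sum_path p u :
  (out_sum (fun a => a \in path_arcs p) u + (z == u) =
   passes_through [set u] p)%N.
Proof.
rewrite /out_sum (sum_path_arcs p (fun e => e.1 == u)).
rewrite /passes_through setI_eq0 disjoints1 negbK inE.
have [t [-> lt ut]] := npathP p; rewrite count_zip_src -count_uniq_mem //.
by rewrite lastI -cats1 count_cat /= lt addn0.
Qed.

Lemma load_st_flow g : st_flow y z (Posz \o load g) (size g)%:Z.
Proof.
move=> u; elim: g => [|p g IH].
  by rewrite mul0r excess_nat /out_sum !big1.
rewrite (eq_excess (g := fun a =>
  (a \in path_arcs p : nat)%:Z + (Posz \o load g) a)) //.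
by rewrite excessD IH excess_path /= -[in RHS]addn1 PoszD; ring.
Qed.

Lemma out_sum_load g u :
  (out_sum (load g) u + (z == u) * size g = passing_count [set u] g)%N.
Proof.
elim: g => [|p g IH]; first by rewrite muln0 addn0 /out_sum big1.
rewrite /passing_count /= -/(passing_count _ _) -IH -out_sum_path mulnS.
by rewrite addnACA -big_split.
Qed.

(** * Decomposition of flows into paths *)

(** Otherwise the set of vertices reachable from y in the support of f would
    have positive total excess although no flow leaves it. *)
Lemma support_path (f : arc V -> nat) (m : nat) :
    y <> z -> (forall a, f a <= N a)%N -> st_flow y z (Posz \o f) m.+1%:Z ->
  exists p, forall a, a \in path_arcs p -> (0 < f a)%N.
Proof.
move=> yz fN fm.
pose e : rel V := fun u v =>
  [exists a : arc V, [&& src a == u, tgt a == v & 0 < f a]%N].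
have /connectP[q eq zq] : connect e y z.
  apply/negPn/negP => nyz; pose S := [set u | connect e y u].
  have : \sum_(u in S) excess (Posz \o f) u = m.+1%:Z.
    rewrite (bigD1 y) ?inE //= big1 => [|u /andP[uS uy]].
      by rewrite addr0 fm eqxx; have /eqP/negPf-> := yz; rewrite subr0 mulr1.
    rewrite fm (negPf uy); case: eqP uS => [->|_ _]; last by rewrite subr0 mulr0.
    by rewrite inE (negPf nyz).
  suff : \sum_(u in S) excess (Posz \o f) u <= 0 by lia.
  rewrite sum_excess sumr_le0 // => a _; rewrite !inE /=.
  have [ya|nya] := boolP (connect e y (src a)); last first.
    by case: (connect e y (tgt a)) => /=; lia.
  have [fa|] := posnP (f a); first by rewrite fa mul0r.
  move=> fa; rewrite (connect_trans ya) ?subrr ?mulr0 //; apply: connect1.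
  by apply/existsP; exists a; rewrite !eqxx.
case/shortenP: eq zq => t et ut _ zt.
have sP : is_path N y z (y :: t).
  apply/and5P; split; rewrite -?zt //.
    by case: t zt {et ut} => //= zy; case: yz.
  apply: sub_path et => u v /existsP[a /and3P[su tv fa]].
  by apply/existsP; exists a; rewrite su tv (leq_trans fa).
exists (exist _ (Bseq (is_path_size sP)) sP : npath N y z) => a.
rewrite inE /= => /(path_zip et) /existsP[b /and3P[/eqP sb /eqP tb fb]].
suff -> : a = b by []; apply: val_inj.
rewrite [val a]surjective_pairing [val b]surjective_pairing.
by congr (_, _).
Qed.

(** Subtracting a path of the support lowers the value by one.  After m steps
    only a circulation is left, which is discarded: hence an inequality. *)
Lemma flow_decomposition (f : arc V -> nat) (m : nat) :
    y <> z -> (forall a, f a <= N a)%N -> st_flow y z (Posz \o f) m%:Z ->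
  exists2 g, size g = m & forall a, (load g a <= f a)%N.
Proof.
move=> yz; elim: m f => [|m IH] f fN fm; first by exists [::].
have [p pf] := support_path yz fN fm.
pose f' a := (f a - (a \in path_arcs p))%N.
have [|u|g sg gf] := IH f' _ _.
- by move=> a; rewrite (leq_trans (leq_subr _ _)).
- rewrite (eq_excess (g := fun a =>
    (Posz \o f) a - (a \in path_arcs p : nat)%:Z)).
    by rewrite excessB fm excess_path; lia.
  by move=> a /=; rewrite /f'; have := pf a; case: (a \in _) => /=; lia.
exists (p :: g) => [|a]; first by rewrite /= sg.
have := pf a; have := gf a; rewrite /f' /=.
by case: (a \in _) => /=; lia.
Qed.

End PathLoads.

(** * Augmenting a flow *)

(** Augmenting g directly by f - g would produce f.  Instead only d paths of the
    residual flow f - g are used, so that the outflow of a vertex grows by at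
    most d, whatever f does there. *)
Lemma augment_flow (V : finType) (y z : V)
    (f g : arc V -> nat) (v : int) (d : nat) :
    (2 <= #|V|)%N -> y <> z ->
    st_flow y z (Posz \o f) (v + d%:Z) -> st_flow y z (Posz \o g) v ->
  exists h, [/\ forall a, (h a <= maxn (f a) (g a))%N,
    st_flow y z (Posz \o h) (v + d%:Z) &
    forall u, (out_sum h u <= out_sum g u + d)%N].
Proof.
move=> V2 yz fv gv.
(* The flow f - g in the residual network of g: subtraction being truncated,
   the second term is the use of the reversed arc by g that f does without. *)
pose r a := ((f a - g a) + (g (rev_arc a) - f (rev_arc a)))%N.
have rd : st_flow y z (Posz \o r) d%:Z.
  pose fg a := (f a - g a)%N; pose gf a := (g a - f a)%N.
  move=> u; rewrite (eq_excess (g := fun a =>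
    (Posz \o fg) a + ((Posz \o gf) \o rev_arc) a)) //.
  rewrite excessD excess_rev -excessB.
  rewrite (eq_excess (g := fun a => (Posz \o f) a - (Posz \o g) a)).
    by rewrite excessB fv gv; ring.
  by move=> a; rewrite /fg /gf /=; lia.
have [P sP Pr] :=
  flow_decomposition (N := Network r V2) yz (fun=> leqnn _) rd.
have {}Pr a : (load P a <= r a)%N by exact: Pr.
(* The load of P splits into a part A added to g and a part B that cancels g
   on reversed arcs. *)
pose A a := minn (load P a) (f a - g a).
pose B a := (load P a - (f a - g a))%N.
have Bg a : (B (rev_arc a) <= g a - f a)%N.
  by have := Pr (rev_arc a); rewrite /B /r rev_arcK; lia.
exists (fun a => g a + A a - B (rev_arc a))%N; split.
- by move=> a; rewrite /A; lia.
- move=> u; rewrite (eq_excess (g := fun a =>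
    ((Posz \o g) a + (Posz \o A) a) - ((Posz \o B) \o rev_arc) a)); last first.
    by move=> a /=; have := Bg a; lia.
  rewrite excessB excess_rev excessD opprK -addrA -excessD gv.
  rewrite (eq_excess (g := Posz \o load P)).
    by rewrite load_st_flow sP; ring.
  by move=> a; rewrite /A /B /=; lia.
- move=> u; apply: (@leq_trans (out_sum g u + out_sum (load P) u)).
    rewrite /out_sum -big_split leq_sum // => a _.
    by rewrite (leq_trans (leq_subr _ _)) // leq_add2l geq_minl.
  rewrite leq_add2l -sP (leq_trans _ (count_size (passes_through [set u]) P)) //.
  by rewrite -/(passing_count _ _) -out_sum_load leq_addr.
Qed.

(** * Flow and paths through a vertex *)

Section Throughput.
Variables (V : finType) (N : network V) (y z : V).
Hypothesis hyz : y <> z.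

(** The capacities are those of an arbitrary network [M], so that paths of [N]
    avoiding a set can be turned into flows of the network without it. *)
Lemma arc_disjoint_flow (M : network V) (g : seq (npath N y z)) :
    (forall a, load g a <= M a)%N ->
  exists2 F : bounded_fun M, is_flow y z F & flow_value y F = size g.
Proof.
move=> gM; have [F [Ff Fv _]] := st_flow_is_flow hyz gM (load_st_flow g).
by exists F.
Qed.

Lemma flow_paths (F : bounded_fun N) :
    is_flow y z F -> 0 <= flow_value y F ->
  exists g : seq (npath N y z),
    [/\ arc_disjoint g, Posz (size g) = flow_value y F &
        forall a, (load g a <= F a)%N].
Proof.
move=> Ff; case E: (flow_value y F) => [m|//] _.
have Fm := is_flow_st_flow hyz Ff; rewrite E in Fm.
have FN a : (F a <= N a)%N by rewrite -ltnS.
have [g sg gF] := flow_decomposition hyz FN Fm.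
exists g; split=> //; last by rewrite sg.
by apply/forallP=> a; apply: leq_trans (gF a) (FN a).
Qed.

Lemma max_pathsE : Posz (max_paths N y z) = phi N y z.
Proof.
rewrite /max_paths; case: ex_maxnP => m /existsP[g /forallP gN] mmax.
apply/eqP; rewrite eq_le; apply/andP; split.
  have [F Ff Fv] := arc_disjoint_flow (M := N) (g := g) gN.
  by have := phi_ge Ff; rewrite Fv size_tuple.
have := max_flow_in N y z; rewrite inE => /andP[Ff /eqP Fv].
have [|h [hN hs _]] := flow_paths Ff; first by rewrite Fv phi_ge0.
rewrite -Fv -hs; apply: mmax; apply/existsP.
by exists (in_tuple h).
Qed.

Lemma lambda_le (X : {set V}) (g : seq (npath N y z)) :
    arc_disjoint g -> Posz (size g) = phi N y z ->
  (lambda N y z X <= passing_count X g)%N.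
Proof.
rewrite -max_pathsE => gN [sg]; rewrite /lambda; case: ex_minnP => l _; apply.
have sg' : size g == max_paths N y z by rewrite sg.
by apply/existsP; exists (Tuple sg'); rewrite gN eqxx.
Qed.

Lemma lambda_attained (X : {set V}) : exists g : seq (npath N y z),
  [/\ arc_disjoint g, Posz (size g) = phi N y z &
      passing_count X g = lambda N y z X].
Proof.
rewrite /lambda; case: ex_minnP => l /existsP[g /andP[gN /eqP gl]] _.
by exists g; split; rewrite // size_tuple max_pathsE.
Qed.

Lemma lambda_le_delta x : Posz (lambda N y z [set x]) <= delta N y z [set x].
Proof.
have [F] := delta_attained N y z [set x].
rewrite inE => /andP[Ff /eqP Fv] <-.
have [|g [gN gs gF]] := flow_paths Ff; first by rewrite Fv phi_ge0.
rewrite (le_trans (_ : _ <= Posz (passing_count [set x] g))) //.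
  by rewrite lez_nat lambda_le // gs.
rewrite /flow_through big_set1 /flow_at; case: ifPn => [_|].
  by rewrite -gs lez_nat count_size.
rewrite !inE negb_or => /andP[_ xz].
rewrite lez_nat -out_sum_load [z == x]eq_sym (negPf xz) mul0n addn0.
exact: leq_sum.
Qed.

Lemma phi_set_le_lambda (X : {set V}) :
  phi_set N y z X <= Posz (lambda N y z X).
Proof.
have [g [/forallP gN gs <-]] := lambda_attained X.
pose g' := filter (predC (passes_through X)) g.
have [|F Ff Fv] := arc_disjoint_flow (M := del_network N X) (g := g').
  move=> a; rewrite /= /del_capacity; case: ifP => [aX|_]; last first.
    apply: leq_trans (gN a); rewrite /load /g' count_filter.
    by apply: sub_count => p /andP[].
  rewrite /load /g' count_filter -(count_pred0 g).
  apply: sub_count => p /andP[/path_arcs_vertices[sa ta] /negP[]].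
  apply/set0Pn; case/orP: aX => aX; [exists (src a)|exists (tgt a)].
    by rewrite inE aX.
  by rewrite inE aX.
have := phi_ge Ff; rewrite Fv /g' size_filter /phi_set -gs.
by have := count_predC (passes_through X) g; rewrite /passing_count; lia.
Qed.

(** The maximum flow with small throughput at x is a maximum flow of N_x
    augmented to one of N. *)
Lemma delta_le_phi_set x : delta N y z [set x] <= phi_set N y z [set x].
Proof.
have := max_flow_in N y z; rewrite inE => /andP[fF /eqP fv].
have := max_flow_in (del_network N [set x]) y z.
rewrite inE => /andP[gF /eqP gv].
have fS := is_flow_st_flow hyz fF; rewrite fv in fS.
have gS := is_flow_st_flow hyz gF; rewrite gv in gS.
set f := max_flow N y z in fF fv fS; set g := max_flow _ _ _ in gF gv gS.
have gD a : (g a <= if (src a == x) || (tgt a == x) then 0 else N a)%N.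
  rewrite (@leq_trans (del_capacity N [set x] a)) -1?ltnS ?ltn_ord //.
  by rewrite /del_capacity !inE.
have gX a : (src a == x) || (tgt a == x) -> g a = 0%N :> nat.
  by move=> ax; have := gD a; rewrite ax leqn0 => /eqP.
have gN a : (g a <= N a)%N by apply: leq_trans (gD a) _; case: ifP.
have [g0 ex0] : out_sum (fun a => nat_of_ord (g a)) x = 0%N /\
    excess (fun a => (g a)%:Z) x = 0.
  rewrite (excess_nat (fun a => nat_of_ord (g a))) /out_sum.
  by rewrite !big1 // => a ax; rewrite gX // ax ?orbT.
(* At a terminal x of N_x, the vanishing excess is plus or minus the value. *)
have [xyz|xyz] := boolP (x \in [set y; z]).
  have := delta_le [set x] (max_flow_in N y z); rewrite -/f.
  rewrite /flow_through big_set1 /flow_at xyz fv /phi_set.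
  suff -> : phi (del_network N [set x]) y z = 0 by rewrite subr0.
  have := gS x; rewrite ex0.
  have /eqP/negPf yz := hyz.
  by case/set2P: xyz => ->; rewrite eqxx ?yz 1?eq_sym ?yz; lia.
have [G [GF Gv _]] := st_flow_is_flow hyz gN gS.
have := phi_ge GF; rewrite Gv -subr_ge0 -/(phi_set N y z [set x]).
case E: (phi_set _ _ _ _) => [d|//] _.
have phiE : phi N y z = phi (del_network N [set x]) y z + d%:Z.
  by rewrite -E /phi_set addrC subrK.
rewrite phiE in fS.
have [h [hfg hst hout]] := augment_flow (network_card N) hyz fS gS.
have hN a : (h a <= N a)%N.
  by apply: leq_trans (hfg a) _; rewrite geq_max gN -ltnS ltn_ord.
have [H [HF Hv Hout]] := st_flow_is_flow hyz hN hst.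
apply: le_trans (delta_le [set x] (_ : H \in max_flows N y z)) _.
  by rewrite inE HF Hv -phiE eqxx.
rewrite /flow_through big_set1 /flow_at (negPf xyz) lez_nat Hout.
by have := hout x; rewrite g0.
Qed.

End Throughput.

Theorem corollary23 (V : finType) (N : network V) (x y z : V) (hyz : y <> z) :
  Posz (lambda N y z [set x]) = phi_set N y z [set x] /\
  phi_set N y z [set x] = delta N y z [set x].
Proof.
have ld := lambda_le_delta N hyz x.
have dp := delta_le_phi_set N hyz x.
have pl := phi_set_le_lambda N hyz [set x].
by split; apply: le_anti; apply/andP; split=> //;
  [exact: le_trans dp | exact: le_trans ld].
Qed.
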